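(* Let $\boldsymbol{X}\sim \mathbb{ELS}(\boldsymbol{\lambda},\boldsymbol{\theta},\boldsymbol{\alpha};F_{b},\psi)$ and $\boldsymbol{Y}\sim \mathbb{ELS}(\boldsymbol{\mu},\boldsymbol{\delta},\boldsymbol{\beta};F_{b},\psi)$, where $\boldsymbol{\lambda}=\boldsymbol{\mu}=\lambda\boldsymbol{1}_{n}$ and $\boldsymbol{\alpha}=\boldsymbol{\beta}=\alpha\boldsymbol{1}_{n}$ for scalars $\lambda,\alpha>0$. Suppose that either $\boldsymbol{\theta},\boldsymbol{\delta}\in\mathcal{E}_+$ or $\boldsymbol{\theta},\boldsymbol{\delta}\in\mathcal{D}_+$, and that $w^2\tilde{r}_{b}(w)$ is increasing in $w$. Then $\boldsymbol{\theta}\succeq^{w}\boldsymbol{\delta}$ implies $X_{n-1:n}\leq_{st}Y_{n-1:n}$, provided $\psi/\psi'$ is increasing.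
   Context: ''Increasing'' and ''decreasing'' are meant in the non-strict sense; a prime denotes the derivative. All random variables are nonnegative and absolutely continuous. $F_b$ is a baseline cumulative distribution function with density $f_b$, and $\tilde r_b=f_b/F_b$ is its reversed hazard rate; its argument $w$ ranges over $w>0$. Archimedean copulas: a $d$-monotone generator is a nonincreasing continuous $\psi:[0,\infty)\to[0,1]$ with $\psi(0)=1$, $\psi(\infty)=0$, $(-1)^i\psi^{(i)}(x)\ge0$ for $i=0,1,\dots,d-2$, and $(-1)^{d-2}\psi^{(d-2)}$ nonincreasing and convex. $\phi=\psi^{-1}$ denotes its right-continuous inverse, $\phi(v)=\sup\{x:\psi(x)>v\}$. The ($n$-dimensional) Archimedean copula with ($n$-monotone) generator $\psi$ is $C_\psi(v_1,\dots,v_n)=\psi(\phi(v_1)+\cdots+\phi(v_n))$, $v_i\in[0,1]$. $\boldsymbol{X}=(X_1,\dots,X_n)\sim\mathbb{ELS}(\boldsymbol\lambda,\boldsymbol\theta,\boldsymbol\alpha;F_b,\psi)$ (dependent exponentiated location-scale model), with $\boldsymbol\lambda,\boldsymbol\theta,\boldsymbol\alpha$ having positive entries, means that $X_i$ has distribution function $F_{X_i}(x)=[F_b((x-\lambda_i)/\theta_i)]^{\alpha_i}$ for $x>\lambda_i$ (and $0$ for $x\le\lambda_i$), $i=1,\dots,n$, and the joint distribution function of $\boldsymbol X$ is $C_\psi(F_{X_1}(x_1),\dots,F_{X_n}(x_n))$. $X_{k:n}$ is the $k$th smallest of $X_1,\dots,X_n$, so $X_{n-1:n}$ is the second-largest order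 statistic. $\boldsymbol 1_n=(1,\dots,1)$. $\mathcal D_+=\{(x_1,\dots,x_n):x_1\ge x_2\ge\cdots\ge x_n>0\}$ and $\mathcal E_+=\{(x_1,\dots,x_n):0<x_1\le x_2\le\cdots\le x_n\}$. For vectors $\boldsymbol x,\boldsymbol y$ with increasing rearrangements $x_{1:n}\le\cdots\le x_{n:n}$ and $y_{1:n}\le\cdots\le y_{n:n}$, $\boldsymbol y\succeq^w\boldsymbol x$ ($\boldsymbol x$ is weakly supermajorized by $\boldsymbol y$) means $\sum_{i=1}^k x_{i:n}\ge\sum_{i=1}^k y_{i:n}$ for all $k=1,\dots,n$. $U\le_{st}V$ means $P(U>x)\le P(V>x)$ for all $x$. *)

(* Defs.v *)
From HB Require Import structures.
From mathcomp Require Import all_boot all_order all_algebra.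
From mathcomp Require Import all_classical all_reals all_analysis.
Import Order.TTheory GRing.Theory Num.Theory.
Import numFieldNormedType.Exports.

Set Implicit Arguments.
Unset Strict Implicit.
Unset Printing Implicit Defensive.

Local Open Scope classical_set_scope.
Local Open Scope ring_scope.

(* Only the values on [0, +oo[ matter: total functions on R stand for functions
   on [0, +oo[, and derivatives are taken at points of ]0, +oo[ (for d = 2 and
   psi continuous, convexity on ]0, +oo[ and on [0, +oo[ agree). Meant for
   d >= 2. *)
Record is_generator (R : realType) (d : nat) (psi : R -> R) : Prop :=
  IsGenerator {
    gen_range : forall x : R, 0 <= x -> 0 <= psi x <= 1 ;
    gen_noninc : forall x y : R, 0 <= x -> x <= y -> psi y <= psi x ;
    gen_continuous : {within `[0, +oo[%classic, continuous psi} ;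
    gen0 : psi 0 = 1 ;
    gen_infty : psi x @[x --> +oo] --> (0 : R) ;
    gen_derivable : forall i : nat, (i < d - 2)%N ->
      forall x : R, 0 < x -> derivable (derive1n i psi) x 1 ;
    gen_sign : forall i : nat, (i <= d - 2)%N ->
      forall x : R, 0 < x -> 0 <= (-1) ^+ i * derive1n i psi x ;
    gen_top_noninc : forall x y : R, 0 < x -> x <= y ->
      (-1) ^+ (d - 2) * derive1n (d - 2) psi y <= (-1) ^+ (d - 2) * derive1n (d - 2) psi x ;
    gen_top_convex : convex_function (`]0, +oo[%classic : set R)
      (fun x : R => (-1) ^+ (d - 2) * derive1n (d - 2) psi x)
  }.

(* phi v = sup {x >= 0 : psi x > v}, the supremum being taken in [0, +oo]: it is
   0 on the empty set (v = 1), and phi 0 = +oo when psi never vanishes. *)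
Definition generator_inv (R : realType) (psi : R -> R) (v : R) : \bar R :=
  ereal_sup (0%E |` [set x%:E | x in [set x : R | 0 <= x /\ v < psi x]]).

(* psi on [0, +oo], with psi +oo = 0; -oo is never used. *)
Definition generator_ext (R : realType) (psi : R -> R) (u : \bar R) : R :=
  if u is x%:E then psi x else 0.

Definition arch_copula (R : realType) (n : nat) (psi : R -> R)
    (v : 'I_n -> R) : R :=
  generator_ext psi (\sum_(i < n) generator_inv psi (v i))%E.

(* f is a density of the distribution function F of a nonnegative random
   variable. *)
Record is_baseline (R : realType) (F f : R -> R) : Prop := IsBaseline {
  baseline_meas : measurable_fun [set: R] f ;
  baseline_ge0 : forall w : R, 0 <= f w ;
  baseline_total : (\int[lebesgue_measure]_t (f t)%:E = 1)%E ;
  baseline_cdf : forall w : R,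
    ((F w)%:E = \int[lebesgue_measure]_(t in `]-oo, w]) (f t)%:E)%E ;
  baseline_nonneg : F 0 = 0
}.

(* Reversed hazard rate. Where F w = 0 the quotient is 0 by convention; as
   f >= 0 and F is nondecreasing, this value is harmless for the requirement
   that w ^+ 2 * rev_hazard F f w be increasing. *)
Definition rev_hazard (R : realType) (F f : R -> R) (w : R) : R := f w / F w.

Definition els_cdf (R : realType) (F : R -> R) (lambda theta alpha x : R) : R :=
  if lambda < x then F ((x - lambda) / theta) `^ alpha else 0.

Record ELS (R : realType) (d : measure_display) (T : measurableType d)
    (P : probability T R) (n : nat) (X : 'I_n -> {RV P >-> R})
    (lambda theta alpha : 'I_n -> R) (F psi : R -> R) : Prop := IsELS {
  els_lambda_gt0 : forall i, 0 < lambda i ;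
  els_theta_gt0 : forall i, 0 < theta i ;
  els_alpha_gt0 : forall i, 0 < alpha i ;
  els_marginal : forall (i : 'I_n) (x : R),
    cdf (X i) x = (els_cdf F (lambda i) (theta i) (alpha i) x)%:E ;
  els_joint : forall x : 'I_n -> R,
    P [set t | forall i, X i t <= x i] =
    (arch_copula psi
       (fun i => els_cdf F (lambda i) (theta i) (alpha i) (x i)))%:E
}.

(* x_{k:n}, for 1 <= k <= n *)
Definition kth_smallest (R : realType) (n : nat) (x : 'I_n -> R) (k : nat) : R :=
  nth 0 (sort <=%R [seq x i | i : 'I_n]) k.-1.

Definition order_stat (R : realType) (T : Type) (n : nat)
    (X : 'I_n -> T -> R) (k : nat) : T -> R :=
  fun t => kth_smallest (fun i => X i t) k.

Definition D_plus (R : realType) (n : nat) (x : 'I_n -> R) : Prop :=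
  (forall i, 0 < x i) /\ (forall i j : 'I_n, (i <= j)%N -> x j <= x i).

Definition E_plus (R : realType) (n : nat) (x : 'I_n -> R) : Prop :=
  (forall i, 0 < x i) /\ (forall i j : 'I_n, (i <= j)%N -> x i <= x j).

(* x is weakly supermajorized by y *)
Definition weak_supermaj (R : realType) (n : nat) (y x : 'I_n -> R) : Prop :=
  forall k : nat, (1 <= k <= n)%N ->
    \sum_(1 <= i < k.+1) kth_smallest y i <= \sum_(1 <= i < k.+1) kth_smallest x i.

Definition st_le (R : realType)
    (d1 : measure_display) (T1 : measurableType d1) (P1 : probability T1 R)
    (d2 : measure_display) (T2 : measurableType d2) (P2 : probability T2 R)
    (U : T1 -> R) (V : T2 -> R) : Prop :=
  forall x : R, (P1 [set t | (x < U t)%R] <= P2 [set t | (x < V t)%R])%E.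

(* psi / psi' is increasing on the points of ]0, +oo[ where psi is positive;
   there psi' < 0 as soon as psi is convex and tends to 0 at +oo. The existence
   of psi' is automatic for d-monotone generators with d >= 3, but not for
   d = 2. *)
Definition gen_ratio_increasing (R : realType) (psi : R -> R) : Prop :=
  (forall x : R, 0 < x -> 0 < psi x -> derivable psi x 1) /\
  (forall x y : R, 0 < x -> x <= y -> 0 < psi y ->
     psi x / derive1 psi x <= psi y / derive1 psi y).

(* Main.v *)
Require Import Defs.
From HB Require Import structures.
From mathcomp Require Import all_boot all_order all_algebra.
From mathcomp Require Import all_classical all_reals all_analysis.
From mathcomp Require Import measurable_realfun ring lra.
Import Order.TTheory GRing.Theory Num.Theory.
Import numFieldNormedType.Exports.
Local Open Scope classical_set_scope.
Local Open Scope ring_scope.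

(** Fix [x] and write [A t] for the baseline distribution function at
    [(x - lam) / t]. In the coordinates [u i = phi (A (theta i) `^ al)], the
    distribution function of the second largest variable at [x] is
      [\sum_l psi (S - u l) - (n - 1) * psi S], where [S = \sum_i u i],
    because the events that all variables but the [l]-th are at most [x] meet
    pairwise in the event that all of them are ([prob_order_stat_gt]). So the
    theorem compares one symmetric function at two vectors, the images of
    [theta] and [delta] under [h t = phi (A t `^ al)], in two steps.

    First, [h] is increasing and concave. In the variable [t] the logarithmic
    derivative of [A] is, up to a positive constant, minus the value of
    [w ^ 2 * f w / F w] at [w = (x - lam) / t], which decreases in [t]; hence
    [- ln A] is concave ([baseline_neg_ln_concave]). That [psi / psi'] increases
    means that [ln psi] is concave ([generator_ln_concave]). As
    [ln (psi (h t)) = al * ln (A t)], the function [h] is a concave function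
    followed by the inverse of an increasing convex one
    ([generator_coordinate_concave]). Increasing concave functions preserve weak
    supermajorization ([sum_concave_nondecreasing]). The density is only
    measurable, so the first concavity is obtained from integral bounds on the
    increments of [F] rather than from a derivative.

    Secondly, the symmetric function above increases with weak
    supermajorization, for any decreasing convex [psi]
    ([second_largest_weak_supermaj]).

    The hypothesis on [w ^ 2 * f w / F w] also forces [F] to be positive on all
    of [w > 0] ([baseline_pos]), so that for [x > lam] every coordinate is
    finite; for [x <= lam] all variables exceed [x] almost
    surely. *)

Set Implicit Arguments.
Unset Strict Implicit.
Unset Printing Implicit Defensive.

(** * Concave functions and weak supermajorization *)

(** Concavity as a three-point inequality cleared of denominators: it makes
    sense for any set [D] and is linear in the values of [f]. *)
Definition concave_on (R : realType) (D : set R) (f : R -> R) : Prop :=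
  forall a b c : R, D a -> D c -> a <= b -> b <= c ->
    f a * (c - b) + f c * (b - a) <= f b * (c - a).

Definition slope (R : realType) (f : R -> R) (x y : R) : R :=
  (f x - f y) / (x - y).

Lemma slopeC (R : realType) (f : R -> R) (x y : R) : slope f x y = slope f y x.
Proof. by rewrite /slope -(opprB (f y)) -(opprB y x) invrN mulrNN. Qed.

Lemma concave_slope_r (R : realType) (D : set R) (f : R -> R) (a b c : R) :
  concave_on D f -> D a -> D c -> a < b -> b <= c -> slope f a c <= slope f a b.
Proof.
move=> fD Da Dc ab bc; have := fD a b c Da Dc (ltW ab) bc.
rewrite slopeC (slopeC _ a b) /slope ler_pdivrMr ?subr_gt0 ?(lt_le_trans ab)//.
by rewrite mulrAC ler_pdivlMr ?subr_gt0//; lra.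
Qed.

Lemma concave_slope_l (R : realType) (D : set R) (f : R -> R) (a b c : R) :
  concave_on D f -> D a -> D c -> a <= b -> b < c -> slope f b c <= slope f a c.
Proof.
move=> fD Da Dc ab bc; have := fD a b c Da Dc ab (ltW bc).
rewrite slopeC (slopeC _ a c) /slope ler_pdivrMr ?subr_gt0//.
by rewrite mulrAC ler_pdivlMr ?subr_gt0 ?(le_lt_trans ab)//; lra.
Qed.

Lemma concave_slope_mono (R : realType) (D : set R) (f : R -> R)
    (x1 y1 x2 y2 : R) :
  concave_on D f -> D x1 -> D y1 -> D x2 -> D y2 -> x1 <= x2 -> y1 <= y2 ->
  x1 != y1 -> x2 != y2 -> slope f x2 y2 <= slope f x1 y1.
Proof.
move=> fD.
wlog xy1 : x1 y1 x2 y2 / x1 < y1 => [wl|] D1 E1 D2 E2 x12 y12 n1 n2.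
  have [lt|gt|/eqP e] := ltgtP x1 y1; first exact: wl.
    by rewrite slopeC (slopeC _ x1); apply: wl => //; rewrite eq_sym.
  by rewrite e in n1.
have [lt|gt|/eqP e] := ltgtP x2 y2; last by rewrite e in n2.
  apply: (le_trans (concave_slope_l fD D1 E2 x12 lt)).
  exact: (concave_slope_r fD D1 E2 xy1 y12).
have y1x2 : y1 < x2 by exact: le_lt_trans y12 gt.
rewrite slopeC; apply: (le_trans (concave_slope_l fD E1 D2 y12 gt)).
rewrite slopeC; apply: (@le_trans _ _ (slope f x1 x2)).
  by rewrite slopeC; apply: (concave_slope_l fD D1 D2 (ltW xy1) y1x2).
exact: (concave_slope_r fD D1 D2 xy1 (ltW y1x2)).
Qed.

Lemma concave_increment (R : realType) (D : set R) (f : R -> R) (a b e : R) :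
  concave_on D f -> D a -> D b -> D (a + e) -> D (b + e) -> 0 <= e -> a <= b ->
  f (b + e) - f b <= f (a + e) - f a.
Proof.
move=> fD Da Db Dae Dbe; rewrite le_eqVlt => /predU1P[<-|e0] ab.
  by rewrite !addr0 !subrr.
have ne (x : R) : x + e != x by rewrite -subr_eq0 addrC addKr gt_eqF.
have := concave_slope_mono fD Dae Da Dbe Db _ ab (ne a) (ne b).
rewrite lerD2r => /(_ ab); rewrite /slope.
have -> : a + e - a = e by ring.
have -> : b + e - b = e by ring.
by rewrite ler_pM2r// invr_gt0.
Qed.

(** Summation by parts. The slopes of [f] between [a i] and [b i] decrease with
    [i], and the partial sums of [a i - b i] are nonpositive; each slope can
    therefore be replaced by the next one, and finally by [c], without
    decreasing the sum. Indices with [a i = b i] have no slope and contribute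
    nothing. *)
Lemma sum_concave_le_slope (R : realType) (D : set R) (f : R -> R)
    (a b : nat -> R) (n : nat) (c : R) :
  concave_on D f ->
  (forall i, (i < n)%N -> D (a i)) -> (forall i, (i < n)%N -> D (b i)) ->
  (forall i j, (i <= j)%N -> (j < n)%N -> a i <= a j) ->
  (forall i j, (i <= j)%N -> (j < n)%N -> b i <= b j) ->
  (forall k, (k <= n)%N -> \sum_(i < k) a i <= \sum_(i < k) b i) ->
  (forall i, (i < n)%N -> a i != b i -> c <= slope f (a i) (b i)) ->
  \sum_(i < n) f (a i) - \sum_(i < n) f (b i) <=
  c * (\sum_(i < n) a i - \sum_(i < n) b i).
Proof.
move=> fD; elim: n c => [|n IH] c Da Db am bm ps cs.
  by rewrite !big_ord0 !subr0 mulr0.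
have IH' c' : (forall i, (i < n)%N -> a i != b i -> c' <= slope f (a i) (b i)) ->
    \sum_(i < n) f (a i) - \sum_(i < n) f (b i) <=
    c' * (\sum_(i < n) a i - \sum_(i < n) b i).
  move=> c's; apply: IH => //.
  - by move=> i /ltnW; exact: Da.
  - by move=> i /ltnW; exact: Db.
  - by move=> i j ij /ltnW; exact: am.
  - by move=> i j ij /ltnW; exact: bm.
  - by move=> k /leqW; exact: ps.
have := ps n.+1 (leqnn _); rewrite !big_ord_recr /=.
have [e|ne] := eqVneq (a n) (b n) => psn.
  have := IH' c (fun i lt => cs i (ltnW lt)).
  by rewrite e; lra.
have := IH' (slope f (a n) (b n)) (fun i lt nei => concave_slope_mono fD
  (Da i (ltnW lt)) (Db i (ltnW lt)) (Da n (ltnSn n)) (Db n (ltnSn n))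
  (am _ _ (ltnW lt) (ltnSn n)) (bm _ _ (ltnW lt) (ltnSn n)) nei ne).
have := cs n (ltnSn n) ne.
have -> : f (a n) = f (b n) + slope f (a n) (b n) * (a n - b n).
  by rewrite divfK ?subr_eq0// addrC subrK.
set s := slope _ _ _; move=> cs' h.
have : s * (\sum_(i < n) a i + a n - (\sum_(i < n) b i + b n)) <=
       c * (\sum_(i < n) a i + a n - (\sum_(i < n) b i + b n)).
  by apply: ler_wnM2r => //; lra.
by lra.
Qed.

(** Tomic's inequality: an increasing concave function preserves weak
    supermajorization. *)
Lemma sum_concave_nondecreasing (R : realType) (D : set R) (f : R -> R)
    (a b : nat -> R) (n : nat) :
  concave_on D f -> (forall x y, D x -> D y -> x <= y -> f x <= f y) ->
  (forall i, (i < n)%N -> D (a i)) -> (forall i, (i < n)%N -> D (b i)) ->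
  (forall i j, (i <= j)%N -> (j < n)%N -> a i <= a j) ->
  (forall i j, (i <= j)%N -> (j < n)%N -> b i <= b j) ->
  (forall k, (k <= n)%N -> \sum_(i < k) a i <= \sum_(i < k) b i) ->
  \sum_(i < n) f (a i) <= \sum_(i < n) f (b i).
Proof.
move=> fD fm Da Db am bm ps; rewrite -subr_le0.
rewrite -[leRHS](mul0r (\sum_(i < n) a i - \sum_(i < n) b i)).
apply: (sum_concave_le_slope fD) => // i lt ne.
have [ab|ba|e] := ltgtP (a i) (b i); last by rewrite e eqxx in ne.
- by rewrite slopeC divr_ge0 ?subr_ge0 ?(ltW ab)// fm ?(ltW ab)//; auto.
- by rewrite divr_ge0 ?subr_ge0 ?(ltW ba)// fm ?(ltW ba)//; auto.
Qed.

(** Karamata's inequality: for equal totals the slope bound is multiplied by 0,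
    so monotonicity of [f] is replaced by any lower bound of finitely many
    slopes. *)
Lemma sum_concave_eq_total (R : realType) (D : set R) (f : R -> R)
    (a b : nat -> R) (n : nat) :
  concave_on D f ->
  (forall i, (i < n)%N -> D (a i)) -> (forall i, (i < n)%N -> D (b i)) ->
  (forall i j, (i <= j)%N -> (j < n)%N -> a i <= a j) ->
  (forall i j, (i <= j)%N -> (j < n)%N -> b i <= b j) ->
  (forall k, (k <= n)%N -> \sum_(i < k) a i <= \sum_(i < k) b i) ->
  \sum_(i < n) a i = \sum_(i < n) b i ->
  \sum_(i < n) f (a i) <= \sum_(i < n) f (b i).
Proof.
move=> fD Da Db am bm ps tot; rewrite -subr_le0.
pose c := \big[Num.min/0]_(i < n) slope f (a i) (b i).
suff : \sum_(i < n) f (a i) - \sum_(i < n) f (b i) <=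
    c * (\sum_(i < n) a i - \sum_(i < n) b i) by rewrite tot subrr mulr0.
apply: (sum_concave_le_slope fD) => // i lt _.
by rewrite /c (bigD1 (Ordinal lt)) //= ge_min lexx.
Qed.

(** The distribution function of the second largest of [n] variables coupled by
    the Archimedean copula with generator [psi], in the coordinates
    [w l = phi (F_l x)]. *)
Definition second_largest_cdf (R : realType) (psi : R -> R) (n : nat)
    (w : nat -> R) : R :=
  \sum_(l < n) psi (\sum_(i < n) w i - w l)
  - (n%:R - 1) * psi (\sum_(i < n) w i).

(** Raising the largest [u l] so as to equalize the totals only decreases
    [second_largest_cdf psi n u], because [psi] is convex; for equal totals [S],
    the sum of the [psi (S - u l)] obeys Karamata's inequality. *)
Lemma second_largest_weak_supermaj (R : realType) (psi : R -> R)
    (u v : nat -> R) (n : nat) :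
  concave_on [set x | 0 <= x] (fun x => - psi x) ->
  (forall i, (i < n)%N -> 0 <= u i) -> (forall i, (i < n)%N -> 0 <= v i) ->
  (forall i j, (i <= j)%N -> (j < n)%N -> u i <= u j) ->
  (forall i j, (i <= j)%N -> (j < n)%N -> v i <= v j) ->
  (forall k, (k <= n)%N -> \sum_(i < k) u i <= \sum_(i < k) v i) ->
  second_largest_cdf psi n v <= second_largest_cdf psi n u.
Proof.
case: n => [|m]; first by move=> *; rewrite /second_largest_cdf !big_ord0.
set n := m.+1 => cpsi u0 v0 um vm ps.
have ltm : (m < n)%N by [].
pose Delta := \sum_(i < n) v i - \sum_(i < n) u i.
have Delta0 : 0 <= Delta by rewrite subr_ge0 ps.
pose u' i := if i == m then u m + Delta else u i.
have u'lt i : (i < m)%N -> u' i = u i.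
  by rewrite /u'; case: eqP => // ->; rewrite ltnn.
have u'm : u' m = u m + Delta by rewrite /u' eqxx.
have sumlt (k : nat) : (k <= m)%N -> \sum_(i < k) u' i = \sum_(i < k) u i.
  by move=> km; apply: eq_bigr => i _; rewrite u'lt// (leq_trans (ltn_ord i)).
have tot' : \sum_(i < n) u' i = \sum_(i < n) u i + Delta.
  by rewrite /n !big_ord_recr /= sumlt// u'm addrA.
have tot : \sum_(i < n) u' i = \sum_(i < n) v i.
  by rewrite tot' /Delta addrC subrK.
have u'0 i : (i < n)%N -> 0 <= u' i.
  by move=> lt; rewrite /u'; case: eqP => _; [rewrite addr_ge0// u0|exact: u0].
have u'mono i j : (i <= j)%N -> (j < n)%N -> u' i <= u' j.
  move=> ij jn; have [im|ni] := eqVneq i m.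
    suff -> : j = i by [].
    by apply/eqP; rewrite eqn_leq ij andbT im -ltnS.
  rewrite /u' (negbTE ni); case: (eqVneq j m) => [jm|nj]; last exact: um.
  by apply: ler_wpDr => //; apply: um => //; rewrite -jm.
have ps' k : (k <= n)%N -> \sum_(i < k) u' i <= \sum_(i < k) v i.
  rewrite leq_eqVlt => /predU1P[->|]; first by rewrite tot.
  by rewrite ltnS => km; rewrite sumlt// ps// leqW.
apply: (@le_trans _ _ (second_largest_cdf psi n u')).
  rewrite /second_largest_cdf tot; apply: lerB => //.
  rewrite -lerN2 -!sumrN.
  set S := \sum_(i < n) v i.
  have le_tot (w : nat -> R) (i : nat) : (forall i, (i < n)%N -> 0 <= w i) ->
      (i < n)%N -> w i <= \sum_(i < n) w i.
    move=> w0 lt; rewrite (bigD1 (Ordinal lt)) //= lerDl sumr_ge0// => j _.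
    exact: w0.
  apply: (@sum_concave_eq_total _ [set x | x <= S] (fun x => - psi (S - x))
    u' v n) => //.
  - move=> a b c aS cS ab bc.
    have := cpsi (S - c) (S - b) (S - a).
    rewrite /= !subr_ge0 !lerD2l !lerN2 => /(_ cS aS bc ab).
    have -> : S - a - (S - b) = b - a by ring.
    have -> : S - b - (S - c) = c - b by ring.
    have -> : S - a - (S - c) = c - a by ring.
    by rewrite addrC.
  - by move=> i lt /=; rewrite /S -tot; exact: le_tot.
  - by move=> i lt /=; exact: le_tot.
rewrite /second_largest_cdf tot'; set S := \sum_(i < n) u i.
have uS (i : 'I_m) : u i + u m <= S.
  rewrite /S /n big_ord_recr /= lerD2r (bigD1 i)//= lerDl sumr_ge0// => j _.
  by rewrite u0// (leqW (ltn_ord _)).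
rewrite !big_ord_recr /= u'm.
have -> : S + Delta - (u m + Delta) = S - u m by ring.
have split_psi (T : R) (w : nat -> R) : \sum_(i < m) psi (T - w i) + psi (S - u m)
    - (n%:R - 1) * psi T = psi (S - u m) + \sum_(i < m) (psi (T - w i) - psi T).
  rewrite big_split/= sumrN sumr_const card_ord -(mulr_natl (psi T)) /n mulrSr addrK.
  by ring.
rewrite !split_psi lerD2l; apply: ler_sum => i _; rewrite u'lt//.
have ui0 : 0 <= u i by rewrite u0// (leqW (ltn_ord _)).
have um0 : 0 <= u m by exact: u0.
have iS := uS i.
have := @concave_increment _ _ _ (S - u i) (S + Delta - u i) (u i) cpsi.
rewrite /= !subrK => h; suff : - psi (S + Delta) - - psi (S + Delta - u i) <=
  - psi S - - psi (S - u i) by lra.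
by apply: h; lra.
Qed.

(** * Archimedean generators *)

Lemma concave3_of_derive (R : realType) (f df : R -> R) (a b c : R) :
  a <= b -> b <= c -> {within `[a, c], continuous f} ->
  (forall x, a < x < c -> is_derive x 1 f (df x)) ->
  (forall x y, a < x -> x <= y -> y < c -> df y <= df x) ->
  f a * (c - b) + f c * (b - a) <= f b * (c - a).
Proof.
move=> ab bc cf dfE dfm.
have [<-|nab] := eqVneq a b; first by lra.
have [<-|nbc] := eqVneq b c; first by lra.
have {nab}ltab : a < b by rewrite lt_neqAle nab.
have {nbc}ltbc : b < c by rewrite lt_neqAle nbc.
have cfab : {within `[a, b], continuous f}.
  apply: continuous_subspaceW cf; apply: subset_itvl; exact: ltW.
have cfbc : {within `[b, c], continuous f}.
  apply: continuous_subspaceW cf; apply: subset_itvr; exact: ltW.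
have [x|x xab ex] := MVT (df := df) ltab _ cfab.
  by rewrite in_itv/= => /andP[ax xb]; apply: dfE; rewrite ax (lt_le_trans xb).
have [y|y ybc ey] := MVT (df := df) ltbc _ cfbc.
  rewrite in_itv/= => /andP[by_ yc]; apply: dfE.
  by rewrite yc (le_lt_trans ab).
move: xab ybc; rewrite !in_itv/= => /andP[ax xb] /andP[by_ yc].
have xy : df y <= df x by apply: dfm => //; exact: ltW (lt_trans xb by_).
have -> : f c = f b + df y * (c - b) by rewrite -ey addrC subrK.
have -> : f a = f b - df x * (b - a) by rewrite -ex opprB addrC subrK.
have : 0 <= (df x - df y) * ((b - a) * (c - b)).
  by rewrite mulr_ge0 ?mulr_ge0 ?subr_ge0.
by lra.
Qed.

Lemma ler_of_ler_add_scaled (R : realType) (d x y C : R) :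
  0 < d -> (forall e, 0 < e -> e <= d -> x <= y + C * e) -> x <= y.
Proof.
move=> d0 h; apply/ler_addgt0Pr => e e0.
pose k := `|C| + 1.
have k0 : 0 < k by rewrite /k ltr_wpDl.
pose e' := Num.min (e / k) d.
have e'0 : 0 < e' by rewrite /e' lt_min divr_gt0//= d0.
have e'd : e' <= d by rewrite /e' ge_min lexx orbT.
apply: (le_trans (h _ e'0 e'd)); rewrite lerD2l.
apply: (@le_trans _ _ (k * e')).
  by rewrite ler_wpM2r ?(ltW e'0)// (le_trans (ler_norm C))// lerDl.
by rewrite mulrC -ler_pdivlMr// /e' ge_min lexx.
Qed.

(** For [n = 2] convexity is part of the definition; for [n >= 3] it is the
    monotonicity of [psi'], which is either the top-order condition ([n = 3])
    or the sign of [psi''] ([n >= 4]). At the endpoint 0 the inequality survives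
    because [psi 0] is at least any nearby value. *)
Lemma generator_convex (R : realType) (n : nat) (psi : R -> R) :
  (2 <= n)%N -> is_generator n psi ->
  concave_on [set x | 0 <= x] (fun x => - psi x).
Proof.
move=> n2 gp.
have pos (a b c : R) : 0 < a -> a <= b -> b <= c ->
    psi b * (c - a) <= psi a * (c - b) + psi c * (b - a).
  move=> a0 ab bc.
  have [ac|nac] := eqVneq a c.
    have -> : b = a by apply/eqP; rewrite eq_le ab {1}ac bc.
    by rewrite -ac subrr !mulr0 addr0.
  have ltac : a < c by rewrite lt_neqAle nac (le_trans ab).
  have c0 : 0 < c by lra.
  have [n2e|n3] := leqP n 2.
    have {n2e n2}nE : n = 2%N by apply/eqP; rewrite eqn_leq n2e.
    have := gen_top_convex gp; rewrite nE subnn.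
    have t0 : 0 <= (c - b) / (c - a) by rewrite divr_ge0//; lra.
    have t1 : (c - b) / (c - a) <= 1 by rewrite ler_pdivrMr; lra.
    have inD (x : R) : 0 < x -> x \in (`]0, +oo[%classic : set R).
      by move=> x0; rewrite inE/= in_itv/= x0.
    move=> /(_ (Itv01 t0 t1) a c (inD _ a0) (inD _ c0)).
    rewrite !convRE/= !expr0 !mul1r /derive1n/= /unstable.onem.
    have ca0 : c - a != 0 by rewrite subr_eq0 eq_sym.
    set m := (X in psi X).
    have {m}-> : m = b.
      transitivity ((c - b) / (c - a) * a + (1 - (c - b) / (c - a)) * c) => //.
      by field.
    have -> : (c - b) / (c - a) * psi a + (1 - (c - b) / (c - a)) * psi c =
      (psi a * (c - b) + psi c * (b - a)) / (c - a) by field.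
    by rewrite ler_pdivlMr ?subr_gt0.
  have dpsi (x : R) : 0 < x -> derivable psi x 1.
    by move=> x0; apply: (@gen_derivable _ _ _ gp 0%N) => //; rewrite subn_gt0.
  have dE (x : R) : 0 < x -> is_derive x 1 psi (derive1 psi x).
    move=> x0; rewrite derive1E; apply/derivableP; exact: dpsi.
  have cont (f : R -> R) (x y : R) : 0 < x ->
      (forall z : R, 0 < z -> derivable f z 1) -> {within `[x, y], continuous f}.
    move=> x0 df; apply: derivable_within_continuous => z.
    by rewrite in_itv/= => /andP[xz _]; apply: df; exact: lt_le_trans xz.
  have mono (x y : R) : 0 < x -> x <= y -> derive1 psi x <= derive1 psi y.
    move=> x0 xy; have [n3e|n4] := leqP n 3.
      have nE : n = 3%N by apply/eqP; rewrite eqn_leq n3e.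
      have := gen_top_noninc gp x0 xy.
      by rewrite nE /derive1n/= !expr1 !mulN1r lerN2.
    have d1 (z : R) : 0 < z -> derivable (derive1 psi) z 1.
      move=> z0; apply: (@gen_derivable _ _ _ gp 1%N) => //.
      by rewrite ltn_subRL.
    have d2 (z : R) : 0 < z -> 0 <= derive1 (derive1 psi) z.
      move=> z0; have := @gen_sign _ _ _ gp 2%N _ z z0.
      by rewrite sqrrN expr1n mul1r /derive1n/=; apply; rewrite leq_subRL.
    apply: (@ger0_derive1_ndecr _ (derive1 psi) x y) => //.
    - by move=> z; rewrite in_itv/= => /andP[xz _]; apply: d1; lra.
    - by move=> z; rewrite in_itv/= => /andP[xz _]; apply: d2; lra.
    - exact: cont.
  have := @concave3_of_derive _ (fun x => - psi x) (fun x => - derive1 psi x)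
    a b c ab bc.
  move=> h; suff : - psi a * (c - b) + - psi c * (b - a) <= - psi b * (c - a).
    by lra.
  apply: h.
  - by apply: cont => // z z0; apply: derivableN; exact: dpsi.
  - move=> x /andP[ax _]; by apply: is_deriveN; apply: dE; exact: lt_trans ax.
  - by move=> x y ax xy yc; rewrite lerN2 mono//; lra.
move=> a b c /= a0 c0 ab bc.
rewrite !mulNr -opprD lerN2.
have [a0'|na0] := ltP 0 a; first exact: pos.
have a00 : a = 0 by apply/eqP; rewrite eq_le na0.
rewrite a00 in ab *.
have [b0|nb0] := ltP 0 b; last first.
  have -> : b = 0 by lra.
  by lra.
apply: (@ler_of_ler_add_scaled _ b _ _ (psi b - psi c)) => // e e0 eb.
have := pos _ _ _ e0 eb bc.
have : psi e * (c - b) <= psi 0 * (c - b).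
  by rewrite ler_wpM2r ?subr_ge0// (gen_noninc gp)// ltW.
by lra.
Qed.

Lemma generator_strict (R : realType) (n : nat) (psi : R -> R) (x y : R) :
  (2 <= n)%N -> is_generator n psi ->
  0 <= x -> x < y -> 0 < psi x -> psi y < psi x.
Proof.
move=> n2 gp x0 xy px; rewrite lt_neqAle (gen_noninc gp)// ?(ltW xy)// andbT.
apply/eqP => e.
have h (z : R) : y <= z -> psi x <= psi z.
  move=> yz; have z0 : 0 <= z := le_trans (le_trans x0 (ltW xy)) yz.
  have := generator_convex n2 gp x0 z0 (ltW xy) yz; rewrite e => h.
  have : psi x * (y - x) <= psi z * (y - x) by lra.
  by rewrite ler_pM2r// subr_gt0.
have : psi x <= 0.
  apply: (cvgr_to_ge (gen_infty gp)); exists y; split; first exact: num_real.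
  by move=> z /ltW; exact: h.
by rewrite leNgt px.
Qed.

(** Beyond a point where [psi > 0] and [psi' >= 0] a convex function would not
    decrease, so it could not tend to 0. *)
Lemma generator_derive_lt0 (R : realType) (n : nat) (psi : R -> R) (x : R) :
  (2 <= n)%N -> is_generator n psi -> 0 < x -> 0 < psi x ->
  derivable psi x 1 -> derive1 psi x < 0.
Proof.
move=> n2 gp x0 px dx.
pose s := psi x - psi (x + 1).
have s0 : 0 < s by rewrite subr_gt0 (generator_strict n2 gp)// ?ltW//; lra.
suff : derive1 psi x <= - s by lra.
rewrite derive1E ['D_1 psi x]cvg_at_rightE//; apply: limr_le.
  rewrite -(cvg_at_rightE (fun h : R => h^-1 *: ((psi \o shift x) _ - psi x))) //.
  apply: cvg_trans dx; apply: cvg_app.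
  move=> A [e egt0 Ae]; exists e => // y xe ygt0; apply: Ae => //.
  exact/lt0r_neq0.
near=> h.
have h0 : 0 < h by near: h; exact: nbhs_right_gt.
have h1 : h <= 1 by near: h; exact: nbhs_right_le.
have := generator_convex n2 gp (ltW x0) (_ : 0 <= x + 1) (_ : x <= x + h) _.
move=> /(_ _ _ _)/=; rewrite [_ *: _]mulrC ler_pdivrMr// [_%:A]mulr1 /s.
rewrite (addrC h).
have x1 : 0 <= x + 1 by lra.
have xh : x <= x + h by lra.
have xh1 : x + h <= x + 1 by lra.
by move=> /(_ x1 xh xh1); lra.
Unshelve. all: by end_near. Qed.

(** The derivative of [ln psi] is [psi' / psi], the inverse of a negative
    increasing function. *)
Lemma generator_ln_concave (R : realType) (n : nat) (psi : R -> R) :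
  (2 <= n)%N -> is_generator n psi -> gen_ratio_increasing psi ->
  concave_on [set x | 0 <= x /\ 0 < psi x] (fun x => ln (psi x)).
Proof.
move=> n2 gp [dpsi ratio] a b c /= [a0 pa] [c0 pc] ab bc.
have pos (x : R) : 0 <= x -> x <= c -> 0 < psi x.
  by move=> x0 xc; apply: lt_le_trans pc _; exact: (gen_noninc gp).
have neg (x : R) : 0 < x -> x <= c -> derive1 psi x < 0.
  move=> x0 xc; have px := pos _ (ltW x0) xc.
  exact: (generator_derive_lt0 n2 gp x0 px (dpsi _ x0 px)).
apply: (@concave3_of_derive _ (fun x => ln (psi x))
  (fun x => derive1 psi x / psi x)) => //.
- have cpsi : {within `[a, c], continuous psi}.
    apply: continuous_subspaceW (gen_continuous gp) => x /=.
    by rewrite !in_itv/= andbT => /andP[ax _]; exact: le_trans ax.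
  rewrite continuous_subspace_in => x; rewrite inE/= in_itv/= => /andP[ax xc].
  apply: continuous_comp; first exact: cpsi.
  by apply: continuous_ln; apply: pos => //; exact: le_trans ax.
- move=> x /andP[ax xc]; have x0 : 0 < x by lra.
  have px := pos _ (ltW x0) (ltW xc).
  have dx : is_derive x 1 psi (derive1 psi x).
    by rewrite derive1E; apply/derivableP; exact: dpsi.
  have dln := is_derive1_ln px.
  by rewrite mulrC; exact: is_derive1_comp dln dx.
- move=> x y ax xy yc.
  have x0 : 0 < x by lra.
  have y0 : 0 < y by lra.
  have yc' : y <= c by lra.
  have xc' : x <= c by lra.
  have := ratio _ _ x0 xy (pos _ (ltW y0) yc').
  rewrite -[psi x / _]invf_div -[psi y / _]invf_div => h.
  have nx : derive1 psi x / psi x < 0.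
    by rewrite pmulr_llt0 ?neg// invr_gt0 pos// ltW.
  have ny : derive1 psi y / psi y < 0.
    by rewrite pmulr_llt0 ?neg// invr_gt0 pos// ltW.
  by move: h; rewrite lef_nV2// ?negrE.
Qed.

(** As [psi] decreases strictly while it is positive, [x] satisfies [v < psi x]
    exactly when [x < u], and the supremum defining [generator_inv] is [u]. *)
Lemma generator_inv_fin (R : realType) (n : nat) (psi : R -> R) (v : R) :
  (2 <= n)%N -> is_generator n psi -> 0 < v -> v <= 1 ->
  exists u, [/\ 0 <= u, psi u = v & generator_inv psi v = u%:E].
Proof.
move=> n2 gp v0 v1.
have [M [M0 pM]] : exists M, 0 <= M /\ psi M <= v.
  have : \forall x \near +oo, psi x <= v by exact: (cvgr_le _ (gen_infty gp)).
  move=> [M [_ hM]]; exists (`|M| + 1); split; first by rewrite addr_ge0.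
  by apply: hM; apply: le_lt_trans (ler_norm M) _; rewrite ltrDl.
have cpsi : {within `[0, M], continuous psi}.
  apply: continuous_subspaceW (gen_continuous gp) => x /=.
  by rewrite !in_itv/= andbT => /andP[].
have [|u u0M uv] := IVT M0 cpsi (v := v).
  by rewrite (gen0 gp) ge_min le_max pM v1 orbT.
move: u0M; rewrite in_itv/= => /andP[u0 _]; exists u; split => //.
rewrite /generator_inv; apply/eqP; rewrite eq_le; apply/andP; split.
  apply: ge_ereal_sup => _ [->|[x [x0 vx] <-]]; first by rewrite lee_fin.
  rewrite lee_fin leNgt; apply/negP => ux.
  by move: vx; rewrite -uv ltNge (gen_noninc gp)// ltW.
set s := ereal_sup _.
have s0 : (0 <= s)%E by apply: ereal_sup_ubound; left.
rewrite leNgt; apply/negP => su.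
have sfin : s \is a fin_num.
  by rewrite ge0_fin_numE// (lt_trans su)// ltry.
move: s0 su; rewrite -(fineK sfin) lee_fin lte_fin => s0 su.
have : (((fine s + u) / 2)%:E <= s)%E.
  apply: ereal_sup_ubound; right; exists ((fine s + u) / 2) => //=; split; first lra.
  have mu : psi u <= psi ((fine s + u) / 2) by apply: (gen_noninc gp); lra.
  by rewrite -[in ltLHS]uv (generator_strict n2 gp)//; lra.
by rewrite -(fineK sfin) lee_fin; lra.
Qed.

(** * The baseline distribution *)

Lemma local_slope_le (R : realType) (V : R -> R) (a b d m : R) :
  a <= b -> 0 < d ->
  (forall s t, a <= s -> s <= t -> t <= b -> t - s <= d ->
    V t - V s <= m * (t - s)) ->
  V b - V a <= m * (b - a).
Proof.
move=> ab d0 loc.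
suff step (k : nat) : forall x, a <= x -> x <= b -> x - a <= k%:R * d ->
    V x - V a <= m * (x - a).
  apply: (step (Num.bound ((b - a) / d))) => //.
  rewrite -ler_pdivrMr// ltW// archi_boundP// divr_ge0 ?subr_ge0//.
  exact: ltW.
elim: k => [|k IH] x ax xb.
  rewrite mul0r => xa; have -> : x = a by apply/eqP; rewrite eq_le ax; lra.
  by rewrite !subrr mulr0.
rewrite -natr1 mulrDl mul1r => xk.
pose y := Num.max a (x - d).
have ay : a <= y by rewrite le_max lexx.
have yx : y <= x by rewrite ge_max ax; lra.
have xdy : x - d <= y by rewrite le_max lexx orbT.
have yk : y - a <= k%:R * d.
  rewrite lerBlDr ge_max; apply/andP; split; last lra.
  by rewrite lerDr mulr_ge0 ?ler0n// ltW.
have := IH y ay (le_trans yx xb) yk.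
have := loc y x ay yx xb; rewrite lerBlDr -lerBlDl => /(_ xdy).
lra.
Qed.

(** Discrete form of the equation [A' = - gamma A]: [- ln A] has derivative
    [gamma], which is decreasing, so it is concave. The finite-difference bounds
    become bounds on the slopes of [ln A] through [1 - 1 / z <= ln z <= z - 1],
    up to an error that vanishes with the mesh of a subdivision. *)
Lemma neg_ln_concave (R : realType) (A gamma : R -> R) :
  (forall t, 0 < t -> 0 < A t) -> (forall t, 0 < t -> 0 <= gamma t) ->
  (forall s t, 0 < s -> s <= t -> gamma t <= gamma s) ->
  (forall s t, 0 < s -> s <= t -> A s - A t <= gamma s * A s * (t - s)) ->
  (forall s t, 0 < s -> s <= t -> gamma t * A t * (t - s) <= A s - A t) ->
  concave_on [set t | 0 < t] (fun t => - ln (A t)).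
Proof.
move=> A0 g0 gm up low.
have lnle (z : R) : 0 < z -> ln z <= z - 1.
  move=> z0; rewrite -[in leLHS](subrKC 1 z) le_ln1Dx//; lra.
have lnge (z : R) : 0 < z -> 1 - z^-1 <= ln z.
  move=> z0; have := lnle z^-1; rewrite invr_gt0 => /(_ z0).
  by rewrite lnV ?posrE//; lra.
have lnA (s t : R) : 0 < s -> 0 < t -> ln (A s) - ln (A t) = ln (A s / A t).
  by move=> s0 t0; rewrite ln_div// posrE A0.
have ratio a s t d : 0 < a -> a <= s -> s <= t -> t - s <= d ->
    A s * (1 - gamma a * d) <= A t.
  move=> a0 as_ st tsd; have s0 : 0 < s by exact: lt_le_trans as_.
  have ga : gamma s * (t - s) <= gamma a * d.
    by apply: ler_pM; rewrite ?subr_ge0 ?g0 ?gm.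
  have : A s * (gamma s * (t - s)) <= A s * (gamma a * d).
    by rewrite ler_wpM2l// ltW// A0.
  by have := up s t s0 st; lra.
have mesh a : 0 < a -> exists2 d0, 0 < d0 &
    forall d, d <= d0 -> 0 < 1 - gamma a * d.
  move=> a0; have ga := g0 a a0.
  have ga1 : 0 < gamma a + 1 by rewrite ltr_wpDl.
  exists (1 / (gamma a + 1)); first by rewrite divr_gt0.
  move=> d; rewrite ler_pdivlMr// => dle.
  by have [d1|d1] := lerP d 0; nra.
have hi a b : 0 < a -> a <= b -> - ln (A b) - - ln (A a) <= gamma a * (b - a).
  move=> a0 ab; have [d0 d00 small] := mesh a a0.
  pose W := - ln (A b) - - ln (A a).
  apply: (@ler_of_ler_add_scaled _ d0 _ _ (gamma a * W)) => // d d_gt0 /small.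
  set K := 1 - gamma a * d => K0.
  suff : W <= gamma a / K * (b - a).
    by rewrite mulrAC ler_pdivlMr// /K /W; lra.
  apply: (@local_slope_le _ (fun t => - ln (A t)) a b d) => //.
  move=> s t as_ st tb tsd.
  have s0 : 0 < s by exact: lt_le_trans as_.
  have t0 : 0 < t by exact: lt_le_trans st.
  have As := A0 s s0; have At := A0 t t0.
  rewrite opprK addrC lnA//; apply: (le_trans (lnle _ (divr_gt0 As At))).
  have -> : A s / A t - 1 = (A s - A t) / A t by field; rewrite gt_eqF.
  rewrite ler_pdivrMr//.
  have -> : gamma a / K * (t - s) * A t = gamma a * (t - s) * A t / K by ring.
  rewrite ler_pdivlMr//.
  have gs : gamma s * (t - s) <= gamma a * (t - s).
    by rewrite ler_wpM2r ?subr_ge0// gm.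
  have gs0 : 0 <= gamma a * (t - s) by rewrite mulr_ge0 ?subr_ge0 ?g0.
  have h1 : A s - A t <= gamma a * (t - s) * A s.
    apply: (le_trans (up s t s0 st)).
    by rewrite mulrAC ler_wpM2r// ltW.
  have h2 : (A s - A t) * K <= gamma a * (t - s) * A s * K.
    by rewrite ler_wpM2r// ltW.
  apply: (le_trans h2); rewrite -mulrA ler_wpM2l//; exact: ratio.
have lo a b : 0 < a -> a <= b -> gamma b * (b - a) <= - ln (A b) - - ln (A a).
  move=> a0 ab; have [d0 d00 small] := mesh a a0.
  have gb : 0 <= gamma b by rewrite g0//; exact: lt_le_trans ab.
  apply: (@ler_of_ler_add_scaled _ d0 _ _ (gamma b * (b - a) * gamma a)) => // d.
  move=> d_gt0 /small; set K := 1 - gamma a * d => K0.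
  suff : ln (A b) - ln (A a) <= - (gamma b * K) * (b - a) by rewrite /K; lra.
  apply: (@local_slope_le _ (fun t => ln (A t)) a b d) => //.
  move=> s t as_ st tb tsd.
  have s0 : 0 < s by exact: lt_le_trans as_.
  have t0 : 0 < t by exact: lt_le_trans st.
  have As := A0 s s0; have At := A0 t t0.
  rewrite -lerN2 mulNr opprK opprB lnA//.
  apply: (le_trans _ (lnge _ (divr_gt0 As At))).
  have -> : 1 - (A s / A t)^-1 = (A s - A t) / A s.
    by rewrite invf_div; field; rewrite gt_eqF.
  rewrite ler_pdivlMr//.
  apply: (le_trans _ (low s t s0 st)).
  have ts0 : 0 <= t - s by rewrite subr_ge0.
  have h1 : gamma b * (t - s) <= gamma t * (t - s) by rewrite ler_wpM2r// gm.
  have h2 : gamma b * (t - s) * A t <= gamma t * (t - s) * A t.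
    by rewrite ler_wpM2r// ltW.
  have h3 : gamma b * (t - s) * (A s * K) <= gamma b * (t - s) * A t.
    by rewrite ler_wpM2l ?mulr_ge0//; exact: ratio.
  by lra.
move=> a b c /= a0 c0 ab bc.
have b0 : 0 < b by exact: lt_le_trans ab.
have h1 := lo a b a0 ab; have h2 := hi b c b0 bc.
have : (- ln (A c) - - ln (A b)) * (b - a) <= gamma b * (c - b) * (b - a).
  by rewrite ler_wpM2r ?subr_ge0.
have : gamma b * (b - a) * (c - b) <= (- ln (A b) - - ln (A a)) * (c - b).
  by rewrite ler_wpM2r ?subr_ge0.
by lra.
Qed.

Lemma continuous_inv_sqr (R : realType) (C a b : R) : 0 < a ->
  {within `[a, b], continuous (fun t : R => C * t ^- 2)}.
Proof.
move=> a0; apply: continuous_in_subspaceT => x; rewrite inE/= in_itv/=.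
move=> /andP[ax _]; have x0 : x != 0 by rewrite gt_eqF// (lt_le_trans a0).
apply: cvgM; first exact: cvg_cst.
by apply: cvgV; [rewrite expf_neq0|exact: exprn_continuous].
Qed.

Lemma measurable_inv_sqr (R : realType) (C a b : R) : 0 < a ->
  measurable_fun `]a, b] (EFin \o (fun t : R => C * t ^- 2)).
Proof.
move=> a0; apply/measurable_EFinP.
apply: (@measurable_funS _ _ _ _ `[a, b]) => //.
  exact: subset_itv_oc_cc.
apply: subspace_continuous_measurable_fun => //; exact: continuous_inv_sqr.
Qed.

Lemma integral_inv_sqr (R : realType) (C a b : R) : 0 < a -> a < b ->
  (\int[lebesgue_measure]_(t in `]a, b]) (C * t ^- 2)%:E =
   (C * (a^-1 - b^-1))%:E)%E.
Proof.
move=> a0 ab.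
pose F (t : R) := - C * t^-1.
have dF (x : R) : x != 0 -> is_derive x 1 F (C * x ^- 2).
  move=> x0; have dV := is_deriveV x0 (is_derive_id x 1).
  have := is_deriveZ (- C) dV.
  by rewrite scalerA mulNr mulrN opprK [_ *: _]mulr1.
have contF (x : R) : x != 0 -> F y @[y --> x] --> F x.
  move=> x0; apply: differentiable_continuous; apply/derivable1_diffP.
  by have [] := dF x x0.
rewrite integral_itv_obnd_cbnd; last exact: measurable_inv_sqr.
rewrite (@continuous_FTC2 _ _ F _ _ ab (continuous_inv_sqr a0)).
- by rewrite -EFinB; congr EFin; rewrite /F; ring.
- split.
  + move=> x; rewrite in_itv/= => /andP[ax _].
    by have [] := dF x (lt0r_neq0 (lt_trans a0 ax)).
  + by apply: cvg_at_right_filter; apply: contF; rewrite gt_eqF.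
  + by apply: cvg_at_left_filter; apply: contF; rewrite gt_eqF// (lt_trans a0).
- move=> x; rewrite in_itv/= => /andP[ax _].
  have d := dF x (lt0r_neq0 (lt_trans a0 ax)).
  by rewrite derive1E derive_val.
Qed.

Section Baseline.
Variables (R : realType) (F f : R -> R).
Hypothesis bF : is_baseline F f.

Local Notation mu := (@lebesgue_measure R).

Lemma baseline_density_meas (D : set R) :
  measurable_fun D (EFin \o f).
Proof.
apply/measurable_EFinP; apply: measurable_funTS; exact: (baseline_meas bF).
Qed.

Lemma baseline_diff w1 w2 : w1 <= w2 ->
  ((F w2)%:E = (F w1)%:E + \int[mu]_(t in `]w1, w2]) (f t)%:E)%E.
Proof.
move=> w12; rewrite !(baseline_cdf bF).
rewrite -ge0_integral_setU//=.
- by rewrite -itv_bndbnd_setU// bnd_simp.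
- exact: baseline_density_meas.
- by move=> t _; rewrite lee_fin (baseline_ge0 bF).
- apply/disj_setPS => t []/=; rewrite !in_itv/= => tw1 /andP[w1t _].
  by move: w1t; rewrite ltNge tw1.
Qed.

Lemma baseline_nondecreasing w1 w2 : w1 <= w2 -> F w1 <= F w2.
Proof.
move=> w12; rewrite -lee_fin (baseline_diff w12) leeDl// integral_ge0// => t _.
by rewrite lee_fin (baseline_ge0 bF).
Qed.

Lemma baseline_cdf_ge0 w : 0 <= F w.
Proof.
rewrite -lee_fin (baseline_cdf bF) integral_ge0// => t _.
by rewrite lee_fin (baseline_ge0 bF).
Qed.

Lemma baseline_le1 w : F w <= 1.
Proof.
rewrite -lee_fin (baseline_cdf bF) -(baseline_total bF).
apply: ge0_subset_integral => //; first exact: baseline_density_meas.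
by move=> t _; rewrite lee_fin (baseline_ge0 bF).
Qed.

(** A distribution function with a density does not jump. *)
Lemma baseline_left_zero z : (forall w, w < z -> F w = 0) -> F z = 0.
Proof.
move=> F0.
have z1 : z - 1 <= z by rewrite lerBlDr lerDl.
suff : (F z)%:E = 0%E by move=> [].
rewrite (baseline_diff z1) F0 ?ltrBlDr ?ltrDl// add0e.
rewrite -integral_itv_bndo_bndc; last exact: baseline_density_meas.
rewrite itv_bnd_open_bigcup.
pose D (i : nat) : set R := `]z - 1, z - i.+1%:R^-1]%classic.
have Dm : {homo D : n m / (n <= m)%N >-> (n <= m)%O}.
  move=> n m nm; apply/subsetPset; apply: subset_itvl.
  by rewrite bnd_simp lerD2l lerN2 lef_pV2 ?posrE ?ltr0Sn// ler_nat.
have f0 (i : nat) t : D i t -> (0 <= (EFin \o f) t)%E.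
  by rewrite /= lee_fin (baseline_ge0 bF).
have h := ge0_nondecreasing_set_cvg_integral (mu := mu) Dm
  (fun _ => measurable_itv _) (fun _ => @baseline_density_meas _) f0.
apply: cvg_unique h _ => //.
apply: cvg_near_cst; apply: nearW => i.
have zi : z - 1 <= z - i.+1%:R^-1.
  by rewrite lerD2l lerN2 invf_le1 ?ltr0Sn// ler1n.
have := baseline_diff zi; rewrite !F0 ?add0e//.
- by rewrite ltrBlDr ltrDl.
- by rewrite ltrBlDr ltrDl invr_gt0 ltr0Sn.
Qed.

Hypothesis rev : forall w1 w2 : R, 0 < w1 -> w1 <= w2 ->
  w1 ^+ 2 * rev_hazard F f w1 <= w2 ^+ 2 * rev_hazard F f w2.

Let g w := w ^+ 2 * rev_hazard F f w.

Let g_ge0 w : 0 <= g w.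
Proof.
by rewrite mulr_ge0 ?sqr_ge0// divr_ge0 ?baseline_cdf_ge0// (baseline_ge0 bF).
Qed.

Let densityE t : 0 < t -> 0 < F t -> f t = F t * g t * t ^- 2.
Proof. by move=> t0 Ft; rewrite /g /rev_hazard; field; rewrite !gt_eqF. Qed.

(** Both bounds integrate the density [F t * g t * t ^- 2], with [F] and [g]
    replaced by their values at an endpoint. *)
Lemma baseline_increment_le w1 w2 : 0 < w1 -> w1 <= w2 ->
  (forall t, w1 < t -> t <= w2 -> 0 < F t) ->
  F w2 - F w1 <= F w2 * g w2 * (w1^-1 - w2^-1).
Proof.
move=> w10; rewrite le_eqVlt => /predU1P[<-|w12] Fpos; first by rewrite !subrr mulr0.
rewrite lerBlDl -lee_fin (baseline_diff (ltW w12)) EFinD leeD2l//.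
rewrite -integral_inv_sqr//; apply: ge0_le_integral => //=.
- by move=> t _; rewrite lee_fin (baseline_ge0 bF).
- exact: baseline_density_meas.
- exact: measurable_inv_sqr.
move=> t; rewrite in_itv/= => /andP[w1t tw2].
have t0 : 0 < t by exact: lt_trans w1t.
rewrite lee_fin densityE//; last exact: Fpos.
by rewrite ler_wpM2r ?invr_ge0 ?sqr_ge0// ler_pM ?g_ge0 ?baseline_cdf_ge0
  ?baseline_nondecreasing//; exact: rev.
Qed.

Lemma baseline_increment_ge w1 w2 : 0 < w1 -> w1 <= w2 -> 0 < F w1 ->
  F w1 * g w1 * (w1^-1 - w2^-1) <= F w2 - F w1.
Proof.
move=> w10; rewrite le_eqVlt => /predU1P[<-|w12] Fpos; first by rewrite !subrr mulr0.
rewrite lerBrDl -lee_fin (baseline_diff (ltW w12)) EFinD leeD2l//.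
rewrite -integral_inv_sqr//; apply: ge0_le_integral => //=.
- move=> t _; rewrite lee_fin divr_ge0 ?sqr_ge0// mulr_ge0 ?g_ge0//.
  exact: baseline_cdf_ge0.
- exact: measurable_inv_sqr.
- exact: baseline_density_meas.
move=> t; rewrite in_itv/= => /andP[w1t tw2].
have t0 : 0 < t by exact: lt_trans w1t.
rewrite lee_fin densityE//; last first.
  by rewrite (lt_le_trans Fpos)// baseline_nondecreasing// ltW.
rewrite ler_wpM2r ?invr_ge0 ?sqr_ge0// ler_pM ?g_ge0 ?baseline_cdf_ge0
  ?baseline_nondecreasing//; [exact: ltW|by apply: rev => //; exact: ltW].
Qed.

(** The support cannot start at some [z > 0]: just after [z] the increment of
    [F] would be at most half its value. *)
Lemma baseline_pos w : (exists w1, F w1 != 0) -> 0 < w -> 0 < F w.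
Proof.
move=> [w1 Fw1] w0; rewrite lt_neqAle baseline_cdf_ge0 andbT eq_sym.
apply/negP => /eqP Fw.
pose Z := [set t | F t = 0]; pose z := sup Z.
have supZ : has_sup Z.
  split; first by exists w.
  exists w1 => t /= Ft; rewrite leNgt; apply/negP => /ltW/baseline_nondecreasing.
  by rewrite Ft leNgt lt_neqAle eq_sym Fw1 baseline_cdf_ge0.
have wz : w <= z by apply: ub_le_sup => //; case: supZ.
have z0 : 0 < z by exact: lt_le_trans wz.
have Fz : F z = 0.
  apply: baseline_left_zero => t tz.
  have zt : 0 < z - t by rewrite subr_gt0.
  have [t' /= Ft' tt'] := sup_adherent zt supZ.
  apply/eqP; rewrite eq_le baseline_cdf_ge0 andbT -Ft'.
  by rewrite baseline_nondecreasing// ltW//; move: tt'; rewrite opprB addrC subrK.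
have Fpos t : z < t -> 0 < F t.
  move=> zt; rewrite lt_neqAle baseline_cdf_ge0 andbT eq_sym.
  apply/negP => /eqP Ft; move: zt; rewrite ltNge => /negP; apply.
  by apply: ub_le_sup => //; case: supZ.
pose C := g (z + 1).
have C0 : 0 <= C by exact: g_ge0.
(* [g] is at most [C] up to [z + 1], so this step makes
   [g (z + e) * (z^-1 - (z + e)^-1) < 1]. *)
pose e := Num.min 1 (z ^+ 2 / (2 * (C + 1))).
have C1 : 0 < 2 * (C + 1) by rewrite mulr_gt0// ltr_wpDl.
have e0 : 0 < e by rewrite lt_min ltr01 divr_gt0// exprn_gt0.
have e1 : e <= 1 by rewrite ge_min lexx.
have eC : e * (2 * (C + 1)) <= z ^+ 2.
  by rewrite -ler_pdivlMr// ge_min lexx orbT.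
have ze : z < z + e by rewrite ltrDl.
have := baseline_increment_le z0 (ltW ze) (fun t zt _ => Fpos t zt).
have Fe := Fpos _ ze.
rewrite Fz subr0 -mulrA -[leLHS]mulr1 ler_pM2l// leNgt => /negP; apply.
have gC : g (z + e) <= C by apply: rev; [exact: addr_gt0|rewrite lerD2l].
have -> : z^-1 - (z + e)^-1 = e / (z * (z + e)).
  by field; rewrite !gt_eqF// addr_gt0.
rewrite mulrA ltr_pdivrMr ?mulr_gt0 ?addr_gt0// mul1r.
have : g (z + e) * e <= C * e by rewrite ler_pM2r.
have : 0 < z * e by rewrite mulr_gt0.
have : 0 <= C * e by rewrite mulr_ge0 // ltW.
by rewrite expr2 in eC; lra.
Qed.

(** With [w = c / t], minus the logarithmic derivative of [F (c / t)] in [t] is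
    [w ^+ 2 * rev_hazard F f w / c], which decreases in [t]. *)
Lemma baseline_neg_ln_concave (c : R) : 0 < c -> (exists w, F w != 0) ->
  concave_on [set t | 0 < t] (fun t => - ln (F (c / t))).
Proof.
move=> c0 F_neq0.
have ct (s t : R) : 0 < s -> s <= t -> c / t <= c / s.
  by move=> s0 st; rewrite ler_pM2l// lef_pV2 ?posrE// (lt_le_trans s0).
have ctE (s t : R) : 0 < s -> 0 < t -> (c / t)^-1 - (c / s)^-1 = (t - s) / c.
  by move=> s0 t0; rewrite !invf_div; field; rewrite gt_eqF.
apply: (@neg_ln_concave _ _ (fun t => g (c / t) / c)).
- by move=> t t0; apply: baseline_pos => //; rewrite divr_gt0.
- by move=> t t0; rewrite divr_ge0 ?g_ge0// ltW.
- move=> s t s0 st; rewrite ler_pM2r ?invr_gt0//; apply: rev.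
    by rewrite divr_gt0// (lt_le_trans s0).
  exact: ct.
- move=> s t s0 st; have t0 : 0 < t by exact: lt_le_trans st.
  have := @baseline_increment_le _ _ (divr_gt0 c0 t0) (ct s t s0 st).
  rewrite ctE// => h; apply: (le_trans (h _)).
    by move=> w tw _; apply: baseline_pos => //; apply: lt_trans tw; rewrite divr_gt0.
  by rewrite [leLHS](_ : _ = g (c / s) / c * F (c / s) * (t - s))//; ring.
- move=> s t s0 st; have t0 : 0 < t by exact: lt_le_trans st.
  have Ft : 0 < F (c / t) by apply: baseline_pos => //; rewrite divr_gt0.
  have := @baseline_increment_ge _ _ (divr_gt0 c0 t0) (ct s t s0 st) Ft.
  rewrite ctE//; apply: le_trans.
  by rewrite [leLHS](_ : _ = F (c / t) * g (c / t) * ((t - s) / c))//; ring.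
Qed.

End Baseline.

(** * The scale parameter in the coordinates of the copula *)

Lemma generator_coordinate_mono (R : realType) (n : nat) (psi A h : R -> R)
    (al : R) :
  (2 <= n)%N -> is_generator n psi -> 0 <= al ->
  (forall t, 0 < t -> 0 < A t) ->
  (forall s t, 0 < s -> s <= t -> A t <= A s) ->
  (forall t, 0 < t -> 0 <= h t /\ psi (h t) = A t `^ al) ->
  forall s t, 0 < s -> s <= t -> h s <= h t.
Proof.
move=> n2 gp al0 A0 Am hE s t s0 st; have t0 : 0 < t by exact: lt_le_trans st.
have [hs0 hs] := hE s s0; have [ht0 ht] := hE t t0.
rewrite leNgt; apply/negP => lt; have := generator_strict n2 gp ht0 lt.
rewrite ht hs powR_gt0 ?A0// => /(_ isT); rewrite ltNge => /negP; apply.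
by apply: ge0_ler_powR; rewrite ?nnegrE ?Am// ltW// A0.
Qed.

(** [- ln (psi (h t)) = - al ln (A t)] is concave in [t] and [- ln psi] is convex
    and increasing, so composing with its inverse gives a concave [h]. *)
Lemma generator_coordinate_concave (R : realType) (n : nat) (psi A h : R -> R)
    (al : R) :
  (2 <= n)%N -> is_generator n psi -> gen_ratio_increasing psi -> 0 <= al ->
  (forall t, 0 < t -> 0 < A t) ->
  (forall s t, 0 < s -> s <= t -> A t <= A s) ->
  concave_on [set t | 0 < t] (fun t => - ln (A t)) ->
  (forall t, 0 < t -> 0 <= h t /\ psi (h t) = A t `^ al) ->
  concave_on [set t | 0 < t] h.
Proof.
move=> n2 gp ratio al0 A0 Am Aconc hE a b c /= a0 c0 ab bc.
have hm := generator_coordinate_mono n2 gp al0 A0 Am hE.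
have b0 : 0 < b by exact: lt_le_trans ab.
have lnh t : 0 < t -> 0 < psi (h t) /\ ln (psi (h t)) = al * ln (A t).
  by move=> t0; have [_ ->] := hE t t0; rewrite powR_gt0 ?A0// ln_powR.
have [[ha0 _] [hb0 _] [hc0 _]] := And3 (hE a a0) (hE b b0) (hE c c0).
have [[pa la] [pb lb] [pc lc]] := And3 (lnh a a0) (lnh b b0) (lnh c c0).
have [ac|nac] := eqVneq a c.
  have -> : b = a by apply/eqP; rewrite eq_le ab {1}ac bc.
  by rewrite -ac subrr !mulr0 addr0.
have lac : a < c by rewrite lt_neqAle nac (le_trans ab).
have [hac|nhac] := eqVneq (h a) (h c).
  have := hm a b a0 ab; rewrite -hac => hab.
  rewrite -mulrDr; have -> : c - b + (b - a) = c - a by ring.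
  by rewrite ler_wpM2r// subr_ge0 ltW.
have lhac : h a < h c by rewrite lt_neqAle nhac hm// ltW.
pose y := (h a * (c - b) + h c * (b - a)) / (c - a).
have ca : 0 < c - a by rewrite subr_gt0.
rewrite -ler_pdivrMr// -/y leNgt; apply/negP => hby.
have y1 : h c - y = (h c - h a) * (c - b) / (c - a).
  by rewrite /y; field; rewrite gt_eqF.
have y2 : y - h a = (h c - h a) * (b - a) / (c - a).
  by rewrite /y; field; rewrite gt_eqF.
have hay : h a <= y.
  by rewrite -subr_ge0 y2 divr_ge0 ?mulr_ge0 ?subr_ge0 ?hm// ltW.
have hyc : y <= h c.
  by rewrite -subr_ge0 y1 divr_ge0 ?mulr_ge0 ?subr_ge0 ?hm// ltW.
have py : 0 < psi y.
  by rewrite (lt_le_trans pc)// (gen_noninc gp)// (le_trans ha0).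
have lny : ln (psi y) < ln (psi (h b)).
  by rewrite ltr_ln ?posrE//; exact: (generator_strict n2 gp hb0 hby pb).
have := generator_ln_concave n2 gp ratio (conj ha0 pa) (conj hc0 pc) hay hyc.
rewrite y1 y2 la lc => L1.
have L2 : (al * ln (A a) * (c - b) + al * ln (A c) * (b - a)) * (h c - h a) <=
          ln (psi y) * (c - a) * (h c - h a).
  move: L1; rewrite -(ler_pM2r ca).
  have -> : (al * ln (A a) * ((h c - h a) * (c - b) / (c - a)) +
    al * ln (A c) * ((h c - h a) * (b - a) / (c - a))) * (c - a) =
    (al * ln (A a) * (c - b) + al * ln (A c) * (b - a)) * (h c - h a).
    by field; rewrite gt_eqF.
  by move=> /le_trans; apply; rewrite mulrAC.
move: L2; rewrite ler_pM2r ?subr_gt0// => L2.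
have L3 : al * (- ln (A a) * (c - b) + - ln (A c) * (b - a)) <=
          al * (- ln (A b) * (c - a)).
  by rewrite ler_wpM2l//; exact: Aconc.
have : ln (psi y) * (c - a) < ln (psi (h b)) * (c - a) by rewrite ltr_pM2r.
by rewrite lb; lra.
Qed.

(** * Order statistics *)

Lemma size_sort_codom (R : realType) (n : nat) (x : 'I_n -> R) :
  size (sort <=%R [seq x i | i : 'I_n]) = n.
Proof. by rewrite size_sort size_map size_enum_ord. Qed.

Lemma sum_kth_smallest (R : realType) (n : nat) (x : 'I_n -> R) (f : R -> R) :
  \sum_(i < n) f (x i) = \sum_(j < n) f (kth_smallest x j.+1).
Proof.
pose s := sort <=%R [seq x i | i : 'I_n].
transitivity (\sum_(y <- s) f y).
  rewrite (perm_big [seq x i | i : 'I_n]) ?perm_sort//=.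
  by rewrite big_map -big_enum.
by rewrite (big_nth 0) size_sort_codom big_mkord.
Qed.

Lemma kth_smallest_mono (R : realType) (n : nat) (x : 'I_n -> R) (i j : nat) :
  (i <= j)%N -> (j < n)%N -> kth_smallest x i.+1 <= kth_smallest x j.+1.
Proof.
move=> ij jn; rewrite /kth_smallest/=.
apply: (sorted_leq_nth le_trans le_refl) => //; rewrite ?inE ?size_sort_codom//.
  exact: sort_le_sorted.
exact: leq_ltn_trans jn.
Qed.

Lemma kth_smallest_gt0 (R : realType) (n : nat) (x : 'I_n -> R) (j : nat) :
  (forall i, 0 < x i) -> (j < n)%N -> 0 < kth_smallest x j.+1.
Proof.
move=> x0 jn.
have : kth_smallest x j.+1 \in [seq x i | i : 'I_n].
  by rewrite -(mem_sort <=%R) mem_nth// size_sort_codom.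
by move=> /mapP[i _ ->].
Qed.

Lemma weak_supermaj_partial_sums (R : realType) (n : nat) (y x : 'I_n -> R)
    (k : nat) :
  weak_supermaj y x -> (k <= n)%N ->
  \sum_(i < k) kth_smallest y i.+1 <= \sum_(i < k) kth_smallest x i.+1.
Proof.
case: k => [|k] yx kn; first by rewrite !big_ord0.
by have := yx k.+1 kn; rewrite !big_add1 !big_mkord.
Qed.

Lemma sorted_nth_le (R : realType) (s : seq R) (x : R) (k : nat) :
  sorted <=%R s -> (k < size s)%N ->
  (nth 0 s k <= x) = (k < count (fun y => (y <= x)%R) s)%N.
Proof.
elim: s k => [|y s IH] k //= ys ks.
have [yx|xy] := leP y x.
  by case: k ks => [//|k] /= ks; rewrite IH// (path_sorted ys).
have ally : all (fun z => x < z) s.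
  have /allP h := order_path_min le_trans ys.
  by apply/allP => z /h; exact: lt_le_trans.
have -> : count (fun z => z <= x) s = 0%N.
  apply/eqP; rewrite -leqn0 leqNgt -has_count; apply/hasPn => z /(allP ally).
  by rewrite -ltNge.
rewrite ltn0; apply/negbTE; rewrite -ltNge; case: k ks => [//|k] /= ks.
by apply: (allP ally); exact: mem_nth.
Qed.

(** Both sides say that at least [n - 1] of the [y i] are at most [x]. *)
Lemma second_largest_leP (R : realType) (n : nat) (y : 'I_n -> R) (x : R) :
  (2 <= n)%N ->
  kth_smallest y n.-1 <= x <-> exists l, forall i, i != l -> y i <= x.
Proof.
move=> n2; have n0 : (0 < n)%N by exact: leq_trans n2.
rewrite /kth_smallest sorted_nth_le; last 2 first.
- exact: sort_le_sorted.
- by rewrite size_sort_codom; case: n n2 {y n0} => [//|[//|n]] _ /=; rewrite ltnS leqnSn.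
pose A := [set i | y i <= x]%SET.
have -> : count (fun z => z <= x) (sort <=%R [seq y i | i : 'I_n]) = #|A|.
  have /permP -> : perm_eq (sort <=%R [seq y i | i : 'I_n]) [seq y i | i : 'I_n].
    by rewrite perm_sort.
  rewrite count_map -sum1_count big_enum_cond -sum1_card.
  by apply: eq_bigl => i; rewrite [RHS]inE.
have -> : (n.-1.-1 < #|A|)%N = (#|~: A| <= 1)%N.
  have -> : #|A| = (n - #|~: A|)%N by rewrite -[LHS](addnK #|~: A|) cardsC card_ord.
  have sub m b : (2 <= m)%N -> (m.-1.-1 < m - b)%N = (b <= 1)%N.
    case: m => [//|[//|m]] _ /=.
    by rewrite ltn_subRL -[m.+2]addn2 addnC ltn_add2l.
  exact: sub.
split.
  rewrite leq_eqVlt => /orP[/cards1P[l el]|].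
    exists l => i il; have : i \notin ~: A by rewrite el inE.
    by rewrite !inE negbK.
  rewrite ltnS leqn0 cards_eq0 => /eqP e0.
  exists (Ordinal n0) => i _; have : i \notin ~: A by rewrite e0 inE.
  by rewrite !inE negbK.
move=> [l hl]; rewrite -(cards1 l); apply: subset_leq_card; apply/fintype.subsetP => i.
by rewrite !inE; apply: contraR => /hl.
Qed.

(** * The distribution of the second largest order statistic *)

Lemma arch_copulaE (R : realType) (n : nat) (psi : R -> R) (v u : 'I_n -> R) :
  (forall i, generator_inv psi (v i) = (u i)%:E) ->
  arch_copula psi v = psi (\sum_(i < n) u i).
Proof.
by move=> vu; rewrite /arch_copula (eq_bigr _ (fun i _ => vu i)) sumEFin.
Qed.

Section SecondLargest.
Variables (R : realType) (d : measure_display) (T : measurableType d).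
Variables (P : probability T R) (n : nat) (X : 'I_n -> {RV P >-> R}).
Hypothesis n2 : (2 <= n)%N.

Lemma measurable_below (D : {pred 'I_n}) (y : 'I_n -> R) :
  measurable [set t | forall i, i \in D -> X i t <= y i].
Proof.
rewrite (_ : [set t | _] = \bigcap_(i in [set` D]) (X i @^-1` `]-oo, y i])).
  apply: fin_bigcap_measurable => // i _; apply: measurable_funPTI.
  exact: measurable_itv.
apply/seteqP; split=> t /= h i /h; by rewrite /= in_itv.
Qed.

(** Of any two variables, one is at most the second largest. *)
Lemma prob_order_stat_gt_sure x : (forall i, cdf (X i) x = 0%E) ->
  P [set t | (x < order_stat X n.-1 t)%R] = 1%E.
Proof.
move=> X0.
pose B l := [set t | forall i, i != l -> X i t <= x].
pose H i : set T := X i @^-1` `]-oo, x].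
have mH i : measurable (H i).
  by apply: measurable_funPTI; exact: measurable_itv.
pose i0 := Ordinal (ltnW n2); pose i1 := Ordinal n2.
have mB : measurable (\bigcup_l B l).
  apply: fin_bigcup_measurable; first exact: finite_finset.
  by move=> l _; exact: measurable_below.
have -> : [set t | (x < order_stat X n.-1 t)%R] = ~` \bigcup_l B l.
  apply/seteqP; split=> t; rewrite /= ltNge; have h := second_largest_leP _ x n2.
    by move=> /negP gt [l _ tl]; apply: gt; apply/h; exists l.
  by move=> tB; apply/negP => /h[l tl]; apply: tB; exists l.
rewrite probability_setC//.
suff -> : P (\bigcup_l B l) = 0%E by rewrite sube0.
have HU : P (H i0 `|` H i1) = 0%E.
  apply/eqP; rewrite eq_le measure_ge0 andbT.
  have PH i : P (H i) = 0%E by exact: X0.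
  apply: (@le_trans _ _ (P (H i0) + P (H i1))%E); first exact: measureU2.
  by rewrite !PH adde0.
apply: (subset_measure0 _ _ _ HU) => //; first exact: measurableU.
move=> t [l _ tl]; have [l0|nl0] := eqVneq i0 l; [right|left].
  by rewrite /H/= in_itv/=; apply: tl; rewrite -l0.
by rewrite /H/= in_itv/=; exact: tl.
Qed.

Variables (psi : R -> R) (G : 'I_n -> R -> R).
Hypothesis gp : is_generator n psi.
Hypothesis marginal : forall i y, cdf (X i) y = (G i y)%:E.
Hypothesis joint : forall y : 'I_n -> R,
  P [set t | forall i, X i t <= y i] = (arch_copula psi (fun i => G i (y i)))%:E.

Variables (x : R) (u : 'I_n -> R).
Hypothesis u_ge0 : forall i, 0 <= u i.
Hypothesis Gx_gt0 : forall i, 0 < G i x.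
Hypothesis uE : forall i, generator_inv psi (G i x) = (u i)%:E.

Let all_below : set T := [set t | forall i, X i t <= x].
Let all_below_but l : set T := [set t | forall i, i != l -> X i t <= x].

Lemma measurable_all_below : measurable all_below.
Proof.
have := @measurable_below predT (fun=> x).
by congr measurable; apply/seteqP; split=> t /= h i; [exact: h|move=> _].
Qed.

Lemma measurable_all_below_but l : measurable (all_below_but l).
Proof. exact: (measurable_below (fun i => i != l) (fun=> x)). Qed.

Lemma marginal_nondecreasing i y z : y <= z -> G i y <= G i z.
Proof. by move=> yz; rewrite -lee_fin -!marginal cdf_nondecreasing. Qed.

Lemma marginal_le1 i y : G i y <= 1.
Proof. by rewrite -lee_fin -marginal cdf_le1. Qed.

Lemma marginal_cvg1 i e : 0 < e -> exists2 y, x <= y & 1 - e <= G i y.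
Proof.
move=> e0; have : G i y @[y --> +oo] --> (1 : R).
  have /fine_cvgP[_] := cvg_cdfy1 (X i).
  by under [X in X -> _]eq_cvg => y do rewrite /= marginal.
move=> /cvgr_ge/(_ (1 - e)); rewrite ltrBlDr ltrDl => /(_ e0)[M [_ hM]].
exists (Num.max x (M + 1)); first by rewrite le_max lexx.
by apply: hM; rewrite lt_max ltrDl ltr01 orbT.
Qed.

Lemma prob_all_below : P all_below = (psi (\sum_(i < n) u i))%:E.
Proof. by rewrite (joint (fun=> x)) (arch_copulaE (u := u)). Qed.

(** Removing the constraint on [X l] amounts to sending its bound [m] to
    infinity. Both the probability and, by convexity of [psi], the value of the
    copula move by at most [1 - G l m]. *)
Lemma prob_all_below_but l :
  P (all_below_but l) = (psi (\sum_(i < n) u i - u l))%:E.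
Proof.
have cpsi := generator_convex n2 gp.
set s := \sum_(i < n) u i - u l.
have sE : s = \sum_(i < n | i != l) u i.
  by rewrite /s (bigD1 l)//= addrAC subrr add0r.
have s0 : 0 <= s by rewrite sE sumr_ge0.
have Pfin := fin_num_measure P _ (measurable_all_below_but l).
rewrite -(fineK Pfin); congr EFin; set p := fine _.
suff close e : 0 < e -> `|p - psi s| <= e.
  apply/eqP; rewrite -subr_eq0 -normr_le0; apply/ler_addgt0Pr => e e0.
  by rewrite add0r close.
move=> e0; have [m xm me] := marginal_cvg1 l e0.
have Gm0 : 0 < G l m := lt_le_trans (Gx_gt0 l) (marginal_nondecreasing l xm).
have [w [w0 psiw wE]] := generator_inv_fin n2 gp Gm0 (marginal_le1 l m).
pose y i := if i == l then m else x.
pose Bm : set T := [set t | forall i, X i t <= y i].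
have PBm : P Bm = (psi (s + w))%:E.
  rewrite (joint y) (arch_copulaE (u := fun i => if i == l then w else u i)).
    by rewrite (bigD1 l)//= eqxx addrC sE; congr (psi (_ + _))%:E;
      apply: eq_bigr => i /negbTE ->.
  by move=> i; rewrite /y; case: eqP => [->|].
have mBm : measurable Bm.
  have := @measurable_below predT y.
  by congr measurable; apply/seteqP; split=> t /= h i; [exact: h|move=> _].
have sub1 : Bm `<=` all_below_but l.
  by move=> t h i il; have := h i; rewrite /y (negbTE il).
pose H : set T := X l @^-1` `]-oo, m].
have mH : measurable H by apply: measurable_funPTI; exact: measurable_itv.
have PH : P (~` H) = (1 - G l m)%:E.
  by rewrite probability_setC// EFinB -marginal.
have sub2 : all_below_but l `<=` Bm `|` ~` H.
  move=> t h; have [tm|mt] := leP (X l t) m; [left|right].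
    by move=> i; rewrite /y; case: eqP => [->//|/eqP/h].
  by rewrite /H/= in_itv/=; apply/negP; rewrite -ltNge.
have lo : psi (s + w) <= p.
  by rewrite -lee_fin -PBm /p fineK// le_measure// inE//; exact: measurable_all_below_but.
have hi : p <= psi (s + w) + (1 - G l m).
  rewrite -lee_fin EFinD -PBm -PH /p fineK//.
  apply: (@le_trans _ _ (P (Bm `|` ~` H))).
    by rewrite le_measure// inE//; [exact: measurable_all_below_but|
      apply: measurableU => //; exact: measurableC].
  by apply: measureU2 => //; exact: measurableC.
have sw : psi (s + w) <= psi s by rewrite (gen_noninc gp)// lerDl.
have inc : psi s - psi (s + w) <= 1 - G l m.
  have := concave_increment (a := 0) (b := s) (e := w) cpsi.
  rewrite /= !add0r (gen0 gp) psiw => h.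
  suff : - psi (s + w) - - psi s <= - G l m - -1 by lra.
  by apply: h => //; exact: addr_ge0.
by rewrite ler_norml; apply/andP; split; lra.
Qed.

(** At most one [X i] exceeds [x]: either none does, or exactly [X l] does for
    one [l]. *)
Lemma prob_order_stat_gt :
  P [set t | (x < order_stat X n.-1 t)%R] =
  (1 - (\sum_(l < n) psi (\sum_(i < n) u i - u l)
        - (n%:R - 1) * psi (\sum_(i < n) u i)))%:E.
Proof.
pose B l := all_below_but l `\` all_below.
pose U := \big[setU/set0]_(l < n) B l.
have mA := measurable_all_below.
have mB l : measurable (B l).
  by apply: measurableD => //; exact: measurable_all_below_but.
have mU : measurable U by exact: bigsetU_measurable.
have memU t : U t <-> exists l, B l t.
  rewrite /U (eq_bigl (fun l => l \in predT))// -bigcup_pred.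
  by split=> [[l _ lt]|[l lt]]; exists l.
have -> : [set t | (x < order_stat X n.-1 t)%R] = ~` (all_below `|` U).
  apply/seteqP; split=> t; rewrite /= ltNge; have h := second_largest_leP _ x n2.
    move=> /negP gt [tA|/memU[l [tl _]]]; apply: gt; apply/h.
      by exists (Ordinal (ltnW n2)) => i _; exact: tA.
    by exists l.
  move=> tE; apply/negP => /h[l tl]; apply: tE.
  by have [tA|ntA] := pselect (all_below t); [left|right; apply/memU; exists l].
have AU0 : all_below `&` U = set0.
  by rewrite -subset0 => t [tA /memU[l [_]]]; exact.
have trivB : trivIset setT B.
  move=> i j _ _ [t [[ti tA] [tj _]]]; apply/eqP/negPn/negP => ij.
  apply: tA => k; have [ki|/ti//] := eqVneq k i; apply: tj; by rewrite ki.
rewrite probability_setC; last exact: measurableU.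
rewrite EFinB; congr (_ - _)%E.
have -> : P (all_below `|` U) = (P all_below + \sum_(l < n) P (B l))%E.
  by rewrite measureU// measure_semi_additive_ord.
have PB l : P (B l) =
    (psi (\sum_(i < n) u i - u l) - psi (\sum_(i < n) u i))%:E.
  have -> : P (B l) =
      (P (all_below_but l) - P (all_below_but l `&` all_below))%E.
    have fin : (P (all_below_but l) < +oo)%E by rewrite prob_all_below_but ltry.
    exact: measureD (measurable_all_below_but l) mA fin.
  have -> : all_below_but l `&` all_below = all_below.
    by apply/setIidPr => t h i _; exact: h.
  by rewrite prob_all_below_but prob_all_below -EFinB.
rewrite (eq_bigr _ (fun l _ => PB l)) sumEFin prob_all_below -EFinD.
congr EFin; rewrite big_split/= sumrN sumr_const card_ord.
by rewrite -(mulr_natl (psi _)); ring.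
Qed.

End SecondLargest.

(** * Comparison *)

Lemma els_order_stat_gt (R : realType) (n : nat) (psi Fb : R -> R)
    (d : measure_display) (T : measurableType d) (P : probability T R)
    (X : 'I_n -> {RV P >-> R}) (lambda theta alpha : 'I_n -> R)
    (lam al x : R) (h : R -> R) :
  (2 <= n)%N -> is_generator n psi ->
  ELS X lambda theta alpha Fb psi ->
  (forall i, lambda i = lam) -> (forall i, alpha i = al) -> lam < x ->
  (forall t, 0 < t -> 0 < Fb ((x - lam) / t)) ->
  (forall t, 0 < t -> 0 <= h t) ->
  (forall t, 0 < t ->
    generator_inv psi (Fb ((x - lam) / t) `^ al) = (h t)%:E) ->
  P [set t | (x < order_stat X n.-1 t)%R] =
  (1 - second_largest_cdf psi n (fun j => h (kth_smallest theta j.+1)))%:E.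
Proof.
move=> n2 gp els lamE alE lx A0 h0 hE.
have th0 := els_theta_gt0 els.
have cdfE i : els_cdf Fb (lambda i) (theta i) (alpha i) x =
    Fb ((x - lam) / theta i) `^ al by rewrite /els_cdf lamE alE lx.
rewrite (@prob_order_stat_gt _ _ _ _ _ X n2 psi
  (fun i => els_cdf Fb (lambda i) (theta i) (alpha i)) gp (els_marginal els)
  (els_joint els) x (fun i => h (theta i))).
- rewrite (sum_kth_smallest theta h).
  by rewrite (sum_kth_smallest theta (fun t => psi (_ - h t))).
- by move=> i; exact: h0.
- by move=> i; rewrite cdfE powR_gt0 ?A0.
- by move=> i; rewrite cdfE hE.
Qed.

(** Otherwise the marginals would vanish identically instead of tending to 1. *)
Lemma els_baseline_neq0 (R : realType) (n : nat) (psi Fb : R -> R)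
    (d : measure_display) (T : measurableType d) (P : probability T R)
    (X : 'I_n -> {RV P >-> R}) (lambda theta alpha : 'I_n -> R) :
  (0 < n)%N -> ELS X lambda theta alpha Fb psi -> exists w, Fb w != 0.
Proof.
move=> n0 els; pose i := Ordinal n0.
have half : 0 < 1 / 2 :> R by rewrite divr_gt0.
have [y _] := marginal_cvg1 (els_marginal els) 0 i half.
rewrite /els_cdf; case: ifP => _; last by lra.
move=> le; exists ((y - lambda i) / theta i).
apply: contraTneq le => ->; rewrite -ltNge powR0 ?gt_eqF ?(els_alpha_gt0 els)//.
by lra.
Qed.

Theorem theorem3p10 (R : realType) (n : nat) (hn : (2 <= n)%N)
    (psi : R -> R) (hpsi : is_generator n psi)
    (Fb fb : R -> R) (hFb : is_baseline Fb fb)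
    (lambda theta alpha mu delta beta : 'I_n -> R)
    (d1 : measure_display) (T1 : measurableType d1) (P1 : probability T1 R)
    (X : 'I_n -> {RV P1 >-> R}) (hX : ELS X lambda theta alpha Fb psi)
    (d2 : measure_display) (T2 : measurableType d2) (P2 : probability T2 R)
    (Y : 'I_n -> {RV P2 >-> R}) (hY : ELS Y mu delta beta Fb psi)
    (lam al : R) (hlam : 0 < lam) (hal : 0 < al)
    (hlambda : forall i, lambda i = lam) (hmu : forall i, mu i = lam)
    (halpha : forall i, alpha i = al) (hbeta : forall i, beta i = al)
    (hord : (E_plus theta /\ E_plus delta) \/ (D_plus theta /\ D_plus delta))
    (hrev : forall w1 w2 : R, 0 < w1 -> w1 <= w2 ->
      w1 ^+ 2 * rev_hazard Fb fb w1 <= w2 ^+ 2 * rev_hazard Fb fb w2)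
    (hratio : gen_ratio_increasing psi) :
  weak_supermaj theta delta ->
  st_le P1 P2 (order_stat X n.-1) (order_stat Y n.-1).
Proof.
move=> wm x.
have [lx|xl] := ltP lam x; last first.
  rewrite !(prob_order_stat_gt_sure hn)// => i.
    by rewrite (els_marginal hY) /els_cdf hmu ltNge xl.
  by rewrite (els_marginal hX) /els_cdf hlambda ltNge xl.
have c0 : 0 < x - lam by rewrite subr_gt0.
have n0 : (0 < n)%N := ltnW hn.
have F_neq0 := els_baseline_neq0 n0 hX.
pose A t := Fb ((x - lam) / t).
have A0 t : 0 < t -> 0 < A t.
  by move=> t0; apply: (baseline_pos hFb hrev F_neq0); rewrite divr_gt0.
have Am s t : 0 < s -> s <= t -> A t <= A s.
  move=> s0 st; apply: (baseline_nondecreasing hFb).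
  by rewrite ler_pM2l// lef_pV2 ?posrE// (lt_le_trans s0).
have Aconc := baseline_neg_ln_concave hFb hrev c0 F_neq0.
pose h t := fine (generator_inv psi (A t `^ al)).
have hE t : 0 < t -> [/\ 0 <= h t, psi (h t) = A t `^ al
    & generator_inv psi (A t `^ al) = (h t)%:E].
  move=> t0; have At0 : 0 < A t `^ al by rewrite powR_gt0 ?A0.
  have At1 : A t `^ al <= 1.
    have -> : 1 = 1 `^ al :> R by rewrite powR1.
    apply: ge0_ler_powR; rewrite ?nnegrE ?ler01 ?(ltW hal) ?(ltW (A0 t t0))//.
    exact: (baseline_le1 hFb).
  by have [u [u0 pu gu]] := generator_inv_fin hn hpsi At0 At1; rewrite /h gu.
have hpsiE t : 0 < t -> 0 <= h t /\ psi (h t) = A t `^ al by move=> /hE[].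
have hinv t : 0 < t -> generator_inv psi (A t `^ al) = (h t)%:E by move=> /hE[].
have h0 t : 0 < t -> 0 <= h t by move=> /hE[].
have hmono := generator_coordinate_mono hn hpsi (ltW hal) A0 Am hpsiE.
have hconc := generator_coordinate_concave hn hpsi hratio (ltW hal) A0 Am Aconc
  hpsiE.
rewrite (els_order_stat_gt hn hpsi hX hlambda halpha lx A0 h0 hinv).
rewrite (els_order_stat_gt hn hpsi hY hmu hbeta lx A0 h0 hinv).
rewrite lee_fin lerD2l lerN2.
have th0 j : (j < n)%N -> 0 < kth_smallest theta j.+1.
  by apply: kth_smallest_gt0; exact: els_theta_gt0 hX.
have de0 j : (j < n)%N -> 0 < kth_smallest delta j.+1.
  by apply: kth_smallest_gt0; exact: els_theta_gt0 hY.
apply: second_largest_weak_supermaj.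
- exact: generator_convex hn hpsi.
- by move=> j jn; exact/h0/th0.
- by move=> j jn; exact/h0/de0.
- move=> i j ij jn; apply: hmono; last exact: kth_smallest_mono.
  by apply: th0; exact: leq_ltn_trans jn.
- move=> i j ij jn; apply: hmono; last exact: kth_smallest_mono.
  by apply: de0; exact: leq_ltn_trans jn.
- move=> k kn; apply: (sum_concave_nondecreasing hconc).
  + by move=> s t /= s0 _; exact: hmono.
  + by move=> i ik; apply: th0; exact: leq_trans kn.
  + by move=> i ik; apply: de0; exact: leq_trans kn.
  + by move=> i j ij jk; apply: kth_smallest_mono => //; exact: leq_trans kn.
  + by move=> i j ij jk; apply: kth_smallest_mono => //; exact: leq_trans kn.
  + by move=> m mk; apply: weak_supermaj_partial_sums => //; exact: leq_trans kn.
Qed.
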